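(* Let $R$ be a ring, $\tau\in\mathbf{M}_{\mathrm{stab}}(R)$, $a\in\mathbf{G}(R)$ and $y\in\mathbf{X}_{\tau,a}(R)$. Then there are unique $(h,b)\in\mathbf{H}(R)\times\mathbf{G}_\tau(R)$ with $ay=hb$, and the following are equivalent: (i) $\mathbf{X}_{\tau,a}$ is tangential at $y$ over $R$; (ii) $b^2\in\mathbf{Z}(R)$.
   Context: Rings are commutative with $1$. Let $\mathbf{V}$ be a free $\mathbb{Z}$-module of finite rank, $\mathbf{V}^*=\mathrm{Hom}(\mathbf{V},\mathbb{Z})$; fix $e\in\mathbf{V}$, $e^*\in\mathbf{V}^*$ with $e^*(e)=1$. For a ring $R$: $\mathbf{V}(R)=\mathbf{V}\otimes R$, $\mathbf{V}^*(R)=\mathrm{Hom}_R(\mathbf{V}(R),R)$, $\mathbf{M}(R)=\mathrm{End}_R(\mathbf{V}(R))$, $\mathbf{G}(R)=\mathrm{Aut}_R(\mathbf{V}(R))$, $\mathbf{Z}(R)=R^\times$ (scalars). Juxtaposition: $\ell v=\ell(v)$, $xv=x(v)$, $\ell x=\ell\circ x$, $v\ell=(u\mapsto\ell(u)v)$. $\mathbf{V}_H(R)=\{v:e^*v=0\}$, $1_H=1-ee^*$, $\mathbf{M}_H(R)=\mathrm{End}_R(\mathbf{V}_H(R))$ (extended by $0$ on $Re$), $\mathbf{H}(R)=\mathrm{Aut}_R(\mathbf{V}_H(R))$ acting trivially on $Re$ (i.e. $\{g\in\mathbf{G}(R):ge=e,\ e^*g=e^*\}$), $\tau_H=1_H\tau1_H$.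 For an $R$-algebra $R'$: $\mathbf{G}_\tau(R')$ = centralizer of $\tau$ in $\mathbf{G}(R')$; $\mathbf{H}_\sigma(R')$ = centralizer of $\sigma\in\mathbf{M}_H(R)$ in $\mathbf{H}(R')$. $v$ (resp. $\ell$) is $\tau$-cyclic if $R[\tau]v=\mathbf{V}(R)$ (resp. $\ell R[\tau]=\mathbf{V}^*(R)$); $\tau$ is stable if $e$ and $e^*$ are $\tau$-cyclic; $\mathbf{M}_{\mathrm{stab}}(R)$ = stable elements. For $\tau$ stable, $a\in\mathbf{G}(R)$: $\mathbf{X}_{\tau,a}(R')=\{y\in\mathbf{H}_{\tau_H}(R'): ay\in\mathbf{H}(R')\mathbf{G}_\tau(R')\}$. Let $R'=R[\varepsilon]/(\varepsilon^2)$ with the map $R'\to R$, $\varepsilon\mapsto0$. For $y\in\mathbf{X}_{\tau,a}(R)$, $\mathbf{X}_{\tau,a}$ is tangential at $y$ over $R$ if every $y'\in\mathbf{H}_{\tau_H}(R')$ mapping to $y$ under $\mathbf{H}_{\tau_H}(R')\to\mathbf{H}_{\tau_H}(R)$ lies in $\mathbf{X}_{\tau,a}(R')$. *)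

(* Defs.v *)
From HB Require Import structures.
From mathcomp Require Import all_boot all_order all_algebra.

Set Implicit Arguments.
Unset Strict Implicit.
Unset Printing Implicit Defensive.

Import GRing.Theory.
Local Open Scope ring_scope.

(* R[eps]/(eps^2) as pairs [Dual x y] standing for x + y eps.  Rings are      *)
(* [comPzRingType]s, so that the zero ring is not excluded; this is why the   *)
(* quotient {poly %/ 'X^2}, available for nontrivial rings only, is not used. *)
Record dual (R : Type) : Type := Dual { dual_std : R; dual_inf : R }.

Section DualNumbers.
Variable R : comPzRingType.
Implicit Types u v w : dual R.

Definition pair_of_dual u : R * R := (dual_std u, dual_inf u).
Definition dual_of_pair (p : R * R) : dual R := Dual p.1 p.2.

Lemma pair_of_dualK : cancel pair_of_dual dual_of_pair.
Proof. by case. Qed.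

HB.instance Definition _ := Choice.copy (dual R) (can_type pair_of_dualK).

Definition dual_zero : dual R := Dual 0 0.
Definition dual_one : dual R := Dual 1 0.
Definition dual_eps : dual R := Dual 0 1.
Definition dual_opp u : dual R := Dual (- dual_std u) (- dual_inf u).
Definition dual_add u v : dual R :=
  Dual (dual_std u + dual_std v) (dual_inf u + dual_inf v).
Definition dual_mul u v : dual R :=
  Dual (dual_std u * dual_std v)
       (dual_std u * dual_inf v + dual_inf u * dual_std v).

Lemma dual_addA : associative dual_add.
Proof. by move=> [? ?] [? ?] [? ?]; congr Dual; rewrite /= addrA. Qed.
Lemma dual_addC : commutative dual_add.
Proof. by move=> [? ?] [? ?]; congr Dual; rewrite /= addrC. Qed.
Lemma dual_add0 : left_id dual_zero dual_add.
Proof. by move=> [? ?]; congr Dual; rewrite /= add0r. Qed.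
Lemma dual_addN : left_inverse dual_zero dual_opp dual_add.
Proof. by move=> [? ?]; congr Dual; rewrite /= addNr. Qed.

HB.instance Definition _ :=
  GRing.isZmodule.Build (dual R) dual_addA dual_addC dual_add0 dual_addN.

Lemma dual_mulA : associative dual_mul.
Proof.
move=> [? ?] [? ?] [? ?]; congr Dual; rewrite /= ?mulrA //.
by rewrite mulrDr mulrDl !mulrA addrA.
Qed.
Lemma dual_mulC : commutative dual_mul.
Proof.
move=> [x x'] [y y']; congr Dual => /=; first exact: mulrC.
by rewrite addrC (mulrC x') (mulrC x).
Qed.
Lemma dual_mul1 : left_id dual_one dual_mul.
Proof. by move=> [? ?]; congr Dual; rewrite /= !mul1r // mul0r addr0. Qed.
Lemma dual_mulDl : left_distributive dual_mul dual_add.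
Proof. by move=> [? ?] [? ?] [? ?]; congr Dual; rewrite /= !mulrDl // addrACA. Qed.

HB.instance Definition _ :=
  GRing.Zmodule_isComPzRing.Build (dual R)
    dual_mulA dual_mulC dual_mul1 dual_mulDl.

Lemma dual_epsM : dual_eps * dual_eps = 0.
Proof. by congr Dual; rewrite /= !(mul0r, mulr0, addr0). Qed.

Definition dual_const (x : R) : dual R := Dual x 0.

Lemma dual_const_zmod : zmod_morphism dual_const.
Proof. by move=> x y; congr Dual; rewrite /= subr0. Qed.
Lemma dual_const_monoid : monoid_morphism dual_const.
Proof. by split=> // x y; congr Dual; rewrite /= mulr0 mul0r addr0. Qed.

HB.instance Definition _ :=
  GRing.isZmodMorphism.Build R (dual R) dual_const dual_const_zmod.
HB.instance Definition _ :=
  GRing.isMonoidMorphism.Build R (dual R) dual_const dual_const_monoid.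

Lemma dual_std_zmod : zmod_morphism (@dual_std R).
Proof. by []. Qed.
Lemma dual_std_monoid : monoid_morphism (@dual_std R).
Proof. by []. Qed.

HB.instance Definition _ :=
  GRing.isZmodMorphism.Build (dual R) R (@dual_std R) dual_std_zmod.
HB.instance Definition _ :=
  GRing.isMonoidMorphism.Build (dual R) R (@dual_std R) dual_std_monoid.

Lemma dualE u : u = dual_const (dual_std u) + dual_const (dual_inf u) * dual_eps.
Proof.
by case: u => x y; congr Dual; rewrite /= ?(mulr1, mulr0, mul0r, addr0, add0r).
Qed.

End DualNumbers.

(* After the choice of a basis, V = Z^n (columns), V^* = rows,                *)
(* V(R) = 'cV[R]_n, V^*(R) = 'rV[R]_n, M(R) = 'M[R]_n acting on columns from  *)
(* the left, and all juxtapositions are [*m].  The vector e and the form e^*  *)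
(* are integral and are pushed to R along Z -> R.                             *)
(* A commutative R-algebra R' is given by its structure morphism f : R -> R'. *)

Definition base_vec (n : nat) (e : 'cV[int]_n) (R : comPzRingType) : 'cV[R]_n :=
  map_mx intr e.
Definition base_form (n : nat) (es : 'rV[int]_n) (R : comPzRingType) :
  'rV[R]_n := map_mx intr es.

Section Groups.
Variables (n : nat) (e : 'cV[int]_n) (es : 'rV[int]_n).

Definition in_G (R : comPzRingType) (g : 'M[R]_n) : Prop :=
  exists g' : 'M[R]_n, g *m g' = 1%:M /\ g' *m g = 1%:M.

(* b \in Z(R), i.e. b is multiplication by an element of R^* *)
Definition in_Z (R : comPzRingType) (b : 'M[R]_n) : Prop :=
  exists r s : R, r * s = 1 /\ b = r%:M.

Definition in_H (R : comPzRingType) (g : 'M[R]_n) : Prop :=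
  [/\ in_G g, g *m base_vec e R = base_vec e R
    & base_form es R *m g = base_form es R].

Definition one_H (R : comPzRingType) : 'M[R]_n :=
  1%:M - base_vec e R *m base_form es R.

Definition restr_H (R : comPzRingType) (tau : 'M[R]_n) : 'M[R]_n :=
  one_H R *m tau *m one_H R.

Definition in_Gcent (R R' : comPzRingType) (f : {rmorphism R -> R'})
  (tau : 'M[R]_n) (g : 'M[R']_n) : Prop :=
  in_G g /\ g *m map_mx f tau = map_mx f tau *m g.

(* sigma in M_H(R) is extended by 0 on Re, and elements of H(R') fix e, so    *)
(* commuting on V_H(R') amounts to commuting as n x n matrices.               *)
Definition in_Hcent (R R' : comPzRingType) (f : {rmorphism R -> R'})
  (sigma : 'M[R]_n) (g : 'M[R']_n) : Prop :=
  in_H g /\ g *m map_mx f sigma = map_mx f sigma *m g.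

(* x \in R[tau] *)
Definition in_alg_gen (R : comPzRingType) (tau x : 'M[R]_n) : Prop :=
  exists (m : nat) (c : 'I_m -> R), x = \sum_(i < m) c i *: tau ^+ i.

Definition cyclic_vec (R : comPzRingType) (tau : 'M[R]_n) (v : 'cV[R]_n) : Prop :=
  forall u : 'cV[R]_n, exists2 x, in_alg_gen tau x & u = x *m v.

Definition cyclic_form (R : comPzRingType) (tau : 'M[R]_n) (l : 'rV[R]_n) : Prop :=
  forall k : 'rV[R]_n, exists2 x, in_alg_gen tau x & k = l *m x.

Definition stable (R : comPzRingType) (tau : 'M[R]_n) : Prop :=
  cyclic_vec tau (base_vec e R) /\ cyclic_form tau (base_form es R).

Definition in_X (R : comPzRingType) (tau a : 'M[R]_n)
  (R' : comPzRingType) (f : {rmorphism R -> R'}) (y : 'M[R']_n) : Prop :=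
  in_Hcent f (restr_H tau) y /\
  exists h b : 'M[R']_n,
    [/\ in_H h, in_Gcent f tau b & map_mx f a *m y = h *m b].

Definition tangential (R : comPzRingType) (tau a y : 'M[R]_n) : Prop :=
  forall y' : 'M[dual R]_n,
    in_Hcent (@dual_const R) (restr_H tau) y' ->
    map_mx (@dual_std R) y' = y ->
    in_X tau a (@dual_const R) y'.

End Groups.

(* Main.v *)
Require Import Defs.
From HB Require Import structures.
From mathcomp Require Import all_boot all_order all_algebra.

Set Implicit Arguments.
Unset Strict Implicit.
Unset Printing Implicit Defensive.

Import GRing.Theory.
Local Open Scope ring_scope.

(* Since e is tau-cyclic, an element commuting with tau is determined by its  *)
(* value on e; this gives uniqueness.  A tangent vector at y is y u with u in *)
(* R[tau_H] 1_H, and it stays in X iff b u b^-1 = A + B with B commuting with *)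
(* tau and A e = 0, e^* A = 0.  The pairing (p e, q e) |-> e^* p q e          *)
(* (p, q in R[tau]) makes tau, e e^* and hence u self-adjoint, which turns    *)
(* this condition into e^* b u b^-1 = e^* b^-1 u b.  It clearly holds if      *)
(* beta = b^2 is scalar.  Conversely, with l = e^* b^-1, it reads             *)
(* l beta u = l u beta; letting u vary and using that 1_H tau e generates V_H *)
(* over R[tau_H], one gets l(v) e^* beta = l(beta v) e^* for every v.  At     *)
(* v = b e this says that e^* beta is a multiple of e^*, so beta is scalar.   *)

(** A point over y has the form y(1 + eps u) with u e = 0, e^* u = 0 and u commuting with tau_H. By
    uniqueness over R ([decomp_unique]), a factorization of a y(1 + eps u) must be h(1 + eps A)
    times (1 + eps B)b, whence b u b^-1 = A + B. Commuting with tau and A e = 0 pin down B, so the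
    only obstruction is e^* A = 0. Since every such u lies in R[tau_H] 1_H ([centralizer_h]) and is
    therefore self-adjoint ([adjoint_poly_h]), the obstruction becomes e^* b u b^-1 = e^* b^-1 u b.
    [conj_decomp] removes it when b^2 is a scalar unit; [conj_decomp_adjoint], [commutation_spreads]
    and [square_scalar] recover the scalar from the equation for all u. *)

Section MatrixFacts.
Variable R : comPzRingType.

Lemma mulmx_col_inj (m n : nat) (A B : 'M[R]_(m, n)) :
  (forall v : 'cV[R]_n, A *m v = B *m v) -> A = B.
Proof.
move=> AB; apply/matrixP=> i j.
by have /colP/(_ i) := AB (delta_mx j 0); rewrite -!colE !mxE.
Qed.

Lemma mulmx_row_inj (m n : nat) (A B : 'M[R]_(m, n)) :
  (forall l : 'rV[R]_m, l *m A = l *m B) -> A = B.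
Proof.
move=> AB; apply/matrixP=> i j.
by have /rowP/(_ j) := AB (delta_mx 0 i); rewrite -!rowE !mxE.
Qed.

Lemma mulmx11C (A B : 'M[R]_1) : A *m B = B *m A.
Proof. by rewrite (mx11_scalar A) scalar_mxC. Qed.

Lemma inverse_commute (n : nat) (t x x' : 'M[R]_n) :
  x *m x' = 1%:M -> x' *m x = 1%:M -> x *m t = t *m x -> x' *m t = t *m x'.
Proof.
move=> xx' x'x xt.
by rewrite -[x' *m t]mulmx1 -xx' !mulmxA -(mulmxA x') -xt mulmxA x'x mul1mx.
Qed.

End MatrixFacts.

(** * The commutative algebra R[t] *)

Section PolynomialsInAMatrix.
Variables (R : comPzRingType) (n : nat) (t : 'M[R]_n).

(* The subalgebra R[t], in a form that supports induction. *)
Inductive poly_in : 'M[R]_n -> Prop :=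
| poly_in1 : poly_in 1%:M
| poly_inD x y : poly_in x -> poly_in y -> poly_in (x + y)
| poly_inZ c x : poly_in x -> poly_in (c *: x)
| poly_inM x : poly_in x -> poly_in (t *m x).

Lemma poly_in0 : poly_in 0.
Proof. by rewrite -(scale0r 1%:M); apply/poly_inZ/poly_in1. Qed.

Lemma poly_in_gen : poly_in t.
Proof. by have := poly_inM poly_in1; rewrite mulmx1. Qed.

Lemma poly_in_alg_gen x : in_alg_gen t x -> poly_in x.
Proof.
case=> m [c ->]; elim/big_ind: _ => [|y z|i _]; [exact: poly_in0|exact: poly_inD|].
apply: poly_inZ; elim: (nat_of_ord i) => [|k IHk]; first exact: poly_in1.
by rewrite exprS; apply: poly_inM.
Qed.

Lemma poly_in_commute x z : poly_in x -> z *m t = t *m z -> z *m x = x *m z.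
Proof.
move=> + zt; elim=> [|{}x y _ IHx _ IHy|c {}x _ IHx|{}x _ IHx].
- by rewrite mulmx1 mul1mx.
- by rewrite mulmxDr mulmxDl IHx IHy.
- by rewrite -scalemxAr -scalemxAl IHx.
- by rewrite mulmxA zt -mulmxA IHx mulmxA.
Qed.

Lemma poly_in_commutes x : poly_in x -> x *m t = t *m x.
Proof. by move=> px; rewrite (poly_in_commute px). Qed.

Lemma poly_inC x y : poly_in x -> poly_in y -> x *m y = y *m x.
Proof. by move=> px py; apply: poly_in_commute py (poly_in_commutes px). Qed.

Lemma poly_in_mul x y : poly_in x -> poly_in y -> poly_in (x *m y).
Proof.
move=> + py; elim=> [|{}x z _ IHx _ IHz|c {}x _ IHx|{}x _ IHx].
- by rewrite mul1mx.
- by rewrite mulmxDl; apply: poly_inD.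
- by rewrite -scalemxAl; apply: poly_inZ.
- by rewrite -mulmxA; apply: poly_inM.
Qed.

End PolynomialsInAMatrix.

(** * Stable matrices: centralizers and adjoints *)

Section StableMatrix.
Variables (R : comPzRingType) (n : nat) (e : 'cV[R]_n) (es : 'rV[R]_n).
Variable t : 'M[R]_n.
Hypothesis es_e : es *m e = 1%:M.
Hypothesis cyc_e : forall v : 'cV[R]_n, exists2 x, poly_in t x & v = x *m e.
Hypothesis cyc_es : forall l : 'rV[R]_n, exists2 x, poly_in t x & l = es *m x.

Lemma commute_inj x y :
  x *m t = t *m x -> y *m t = t *m y -> x *m e = y *m e -> x = y.
Proof.
move=> xt yt xe_ye; apply: mulmx_col_inj => v; have [p pp ->] := cyc_e v.
by rewrite !mulmxA (poly_in_commute pp xt) (poly_in_commute pp yt) -!mulmxA xe_ye.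
Qed.

Lemma commute_form_inj x y :
  x *m t = t *m x -> y *m t = t *m y -> es *m x = es *m y -> x = y.
Proof.
move=> xt yt xe_ye; apply: mulmx_row_inj => v; have [p pp ->] := cyc_es v.
by rewrite -!mulmxA -(poly_in_commute pp xt) -(poly_in_commute pp yt) !mulmxA xe_ye.
Qed.

(** Cyclicity gives p in R[t] with p e = x e, and [commute_inj] forces x = p. So the centralizer of
    [t] is commutative. *)
Lemma commute_poly_in x : x *m t = t *m x -> poly_in t x.
Proof.
move=> xt; have [p pp xe_pe] := cyc_e (x *m e).
by rewrite (commute_inj xt (poly_in_commutes pp) xe_pe).
Qed.

Lemma form_inj (k l : 'rV[R]_n) :
  (forall c, poly_in t c -> k *m c *m e = l *m c *m e) -> k = l.
Proof.
move=> kl; apply: mulmx_col_inj => v; have [p pp ->] := cyc_e v.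
by rewrite !mulmxA kl.
Qed.

(* [adjoint x x']: x and x' are adjoint for the bilinear form on V given by   *)
(* (p e, q e) |-> es p q e for p, q in R[t]; t is self-adjoint for this form. *)
Definition adjoint (x x' : 'M[R]_n) : Prop :=
  forall p q, poly_in t p -> poly_in t q ->
    es *m p *m x *m q *m e = es *m q *m x' *m p *m e.

Lemma adjoint_poly x : poly_in t x -> adjoint x x.
Proof.
move=> px p q pp pq; rewrite -!(mulmxA es); congr (es *m (_ *m e)).
by rewrite (poly_inC (poly_in_mul pp px) pq) (poly_inC pp px) mulmxA.
Qed.

Lemma adjointD x x' y y' :
  adjoint x x' -> adjoint y y' -> adjoint (x + y) (x' + y').
Proof. by move=> xx' yy' p q pp pq; rewrite !(mulmxDr, mulmxDl) xx' ?yy'. Qed.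

Lemma adjointZ c x x' : adjoint x x' -> adjoint (c *: x) (c *: x').
Proof.
by move=> xx' p q pp pq; rewrite -!(scalemxAr, scalemxAl) xx'.
Qed.

Lemma adjointM x x' y y' :
  adjoint x x' -> adjoint y y' -> adjoint (x *m y) (y' *m x').
Proof.
move=> xx' yy' p q pp pq.
(* Replace y q e by q2 e; adjointness of y and y' says that the same q2 represents the form es q
   y'. *)
have [q2 pq2 yq] := cyc_e (y *m q *m e).
have esq : es *m q *m y' = es *m q2.
  apply: form_inj => c pc; rewrite -yy' // -!mulmxA (mulmxA y) yq.
  by rewrite !mulmxA -!(mulmxA es) (poly_inC pc pq2).
by rewrite !mulmxA esq -xx' // -!mulmxA [y *m _]mulmxA yq !mulmxA.
Qed.

(* Variables rather than definitions, so that rewriting does not unfold them. *)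
Variables one_h t_h : 'M[R]_n.
Hypotheses (one_hE : one_h = 1%:M - e *m es) (t_hE : t_h = one_h *m t *m one_h).

(** * The complement V_H and the compression [t_h] *)

Lemma one_h_e : one_h *m e = 0.
Proof. by rewrite one_hE mulmxBl mul1mx -mulmxA es_e mulmx1 subrr. Qed.

Lemma es_one_h : es *m one_h = 0.
Proof. by rewrite one_hE mulmxBr mulmx1 mulmxA es_e mul1mx subrr. Qed.

Lemma one_h_id : one_h *m one_h = one_h.
Proof. by rewrite {2}one_hE mulmxBr mulmx1 mulmxA one_h_e mul0mx subr0. Qed.

Lemma one_h_commute : one_h *m t_h = t_h *m one_h.
Proof. by rewrite t_hE !mulmxA one_h_id -!mulmxA one_h_id. Qed.

Lemma vec_decomp (v : 'cV[R]_n) : v = e *m (es *m v) + one_h *m v.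
Proof. by rewrite one_hE mulmxBl mul1mx mulmxA addrC subrK. Qed.

(** Inserting e e^* splits the pairing into the scalars e^* p e and e^* q e, which commute. *)
Lemma adjoint_one_h : adjoint one_h one_h.
Proof.
rewrite one_hE; apply: adjointD; first exact/adjoint_poly/poly_in1.
rewrite -scaleN1r; apply: adjointZ => p q _ _.
have splitP u v : es *m u *m (e *m es) *m v *m e = (es *m u *m e) *m (es *m v *m e).
  by rewrite !mulmxA.
by rewrite !splitP mulmx11C.
Qed.

Lemma adjoint_t_h : adjoint t_h t_h.
Proof.
rewrite {2}t_hE -mulmxA t_hE; apply: adjointM adjoint_one_h.
by apply: adjointM adjoint_one_h _; apply/adjoint_poly/poly_in_gen.
Qed.

Lemma adjoint_poly_h x : poly_in t_h x -> adjoint (x *m one_h) (x *m one_h).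
Proof.
elim=> [|{}x y _ IHx _ IHy|c {}x _ IHx|{}x px IHx].
- by rewrite mul1mx; apply: adjoint_one_h.
- by rewrite mulmxDl; apply: adjointD.
- by rewrite -scalemxAl; apply: adjointZ.
- have -> : t_h *m x *m one_h = t_h *m (x *m one_h) by rewrite mulmxA.
  rewrite {2}(_ : t_h *m _ = (x *m one_h) *m t_h); first exact: adjointM adjoint_t_h IHx.
  by rewrite -(mulmxA x) one_h_commute (mulmxA x) (poly_in_commutes px) mulmxA.
Qed.

(* The projection of t e to V_H is a t_h-cyclic vector of V_H. *)
Lemma one_h_gen (v : 'cV[R]_n) :
  exists2 x, poly_in t_h x & one_h *m v = x *m (one_h *m t *m e).
Proof.
have [c pc ->] := cyc_e v; elim: pc => {v c}.
- by exists 0; [exact: poly_in0|rewrite mul1mx one_h_e mul0mx].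
- move=> c d _ [x px cx] _ [y py dy]; exists (x + y); first exact: poly_inD.
  by rewrite mulmxDl mulmxDr cx dy mulmxDl.
- move=> s c _ [x px cx]; exists (s *: x); first exact: poly_inZ.
  by rewrite -scalemxAl -scalemxAr cx scalemxAl.
(* Split c e along e and V_H: 1_H t c e = t_h (1_H c e) + (e^* c e) 1_H t e. *)
move=> c _ [x px cx]; exists (t_h *m x + (es *m (c *m e)) 0 0 *: 1%:M).
  by apply: poly_inD; [exact: poly_inM|apply/poly_inZ/poly_in1].
rewrite -mulmxA {1}(vec_decomp (c *m e)) mulmxDr mulmxDr addrC.
rewrite mulmxDl -mulmxA -cx; congr (_ + _).
  by rewrite t_hE !mulmxA -(mulmxA _ one_h one_h) one_h_id.
by rewrite {1}[es *m _]mx11_scalar !mulmxA mul_mx_scalar -!scalemxAl mul1mx.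
Qed.

(** On V_H, u is determined by its value at the cyclic vector [one_h *m t *m e]; x is chosen to
    agree with u there. *)
Lemma centralizer_h u :
  u *m e = 0 -> es *m u = 0 -> u *m t_h = t_h *m u ->
  exists2 x, poly_in t_h x & u = x *m one_h.
Proof.
move=> ue esu ut.
have u1 : one_h *m u = u by rewrite one_hE mulmxBl mul1mx -mulmxA esu mulmx0 subr0.
have [x px] := one_h_gen (u *m (one_h *m t *m e)).
rewrite mulmxA u1 => ux; exists x => //.
apply: mulmx_col_inj => v.
rewrite [in LHS](vec_decomp v) mulmxDr mulmxA ue mul0mx add0r.
have [z pz zv] := one_h_gen v; rewrite -mulmxA zv !mulmxA.
rewrite (poly_in_commute pz ut) (poly_inC px pz) -!mulmxA; congr (z *m _).
by move: ux; rewrite !mulmxA.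
Qed.

(** For u = 1_H, expanding 1_H and cancelling l beta leaves the claim at v = e. For u t 1_H with u =
    x 1_H, which is again in R[t_h] 1_H, cancelling l u t beta leaves it at v = u t e. These vectors
    and e span V. *)
Lemma commutation_spreads (l : 'rV[R]_n) (beta : 'M[R]_n) :
  poly_in t beta ->
  (forall x, poly_in t_h x ->
     l *m beta *m (x *m one_h) = l *m (x *m one_h) *m beta) ->
  forall v : 'cV[R]_n, l *m v *m (es *m beta) = l *m beta *m v *m es.
Proof.
move=> pbeta lbeta.
pose K v := l *m v *m (es *m beta) = l *m beta *m v *m es.
have KD v w : K v -> K w -> K (v + w).
  by move=> Kv Kw; rewrite /K !mulmxDr !mulmxDl Kv Kw.
have KM v w : K v -> K (v *m w).
  rewrite /K => Kv; rewrite [w]mx11_scalar !mul_mx_scalar.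
  by rewrite -!(scalemxAl, scalemxAr) Kv.
have Ke : K e.
  have := lbeta _ (poly_in1 _).
  rewrite mul1mx one_hE !mulmxBr !mulmxBl !mulmx1 !mulmxA => /addrI /oppr_inj.
  by rewrite /K !mulmxA.
have Kg x : poly_in t_h x -> K (x *m (one_h *m t *m e)).
  move=> px; have [u uE] : exists u, u = x *m one_h by exists (x *m one_h).
  have -> : x *m (one_h *m t *m e) = u *m t *m e by rewrite uE !mulmxA.
  have lu := lbeta _ px; rewrite -uE in lu.
  have := lbeta _ (poly_inM px).
  have -> : t_h *m x *m one_h = u *m t *m one_h.
    rewrite -(poly_in_commutes px) -mulmxA -one_h_commute t_hE uE !mulmxA.
    by rewrite -(mulmxA x one_h one_h) one_h_id.
  have -> : l *m beta *m (u *m t *m one_h) =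
            l *m u *m t *m beta - l *m beta *m (u *m t *m e) *m es.
    rewrite {1}one_hE mulmxBr mulmx1 mulmxBr !mulmxA lu -!mulmxA.
    by rewrite (poly_in_commutes pbeta).
  rewrite {1}one_hE mulmxBr mulmx1 mulmxBr mulmxBl !mulmxA => /addrI /oppr_inj.
  by rewrite /K !mulmxA => ->.
move=> v; rewrite -/(K v) (vec_decomp v); have [x px ->] := one_h_gen v.
by apply: KD; [exact: KM | exact: Kg].
Qed.

(** * Conjugating a self-adjoint matrix by b *)

Section Conjugation.
Variables b b' : 'M[R]_n.
Hypotheses (bt : b *m t = t *m b) (bb' : b *m b' = 1%:M) (b'b : b' *m b = 1%:M).

Lemma conj_decomp (r s : R) u :
  r * s = 1 -> b *m b = r%:M -> adjoint u u ->
  exists A B, [/\ b *m u *m b' = A + B, A *m e = 0, es *m A = 0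
                & B *m t = t *m B].
Proof.
move=> rs b2 uu.
have pb := commute_poly_in bt.
have b'E : b' = s *: b.
  rewrite -[LHS]mulmx1 -[in LHS](_ : s *: r%:M = 1%:M).
    by rewrite -scalemxAr -b2 mulmxA b'b mul1mx.
  by rewrite scale_scalar_mx mulrC rs.
(* The only candidate for B: it must agree with b u b' on e. That b' is a multiple of b is what
   makes e^* A vanish. *)
have [B pB Be] := cyc_e (b *m u *m b' *m e).
exists (b *m u *m b' - B), B; split; first by rewrite subrK.
- by rewrite mulmxBl Be subrr.
- apply: form_inj => c pc; rewrite !mul0mx mulmxBr !mulmxBl.
  have -> : es *m B *m c *m e = es *m c *m (b *m u *m b' *m e).
    by rewrite Be -(mulmxA es) (poly_inC pB pc) !mulmxA.
  apply/eqP; rewrite subr_eq0 b'E -!(scalemxAl, scalemxAr); apply/eqP.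
  congr (_ *: _); rewrite !mulmxA.
  have := uu _ _ pb (poly_in_mul pb pc).
  by rewrite !mulmxA => ->; rewrite -(mulmxA es) (poly_inC pb pc) !mulmxA.
- exact: poly_in_commutes.
Qed.

(** A drops out of both e^* c (A + B) e and e^* (A + B) c e, and B commutes with c in R[t];
    self-adjointness of u turns the first into e^* b' u b c e. *)
Lemma conj_decomp_adjoint u A B :
  adjoint u u -> b *m u *m b' = A + B ->
  A *m e = 0 -> es *m A = 0 -> B *m t = t *m B ->
  es *m b *m u = es *m b' *m u *m (b *m b).
Proof.
move=> uu ubE Ae esA Bt.
have pb := commute_poly_in bt.
have pb' := commute_poly_in (inverse_commute bb' b'b bt).
suff ubb : es *m b *m u *m b' = es *m b' *m u *m b.
  by rewrite (mulmxA _ b b) -ubb -(mulmxA _ b' b) b'b mulmx1.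
apply: form_inj => c pc.
have := uu _ _ (poly_in_mul pb pc) pb'.
rewrite {1}(poly_inC pb pc) !mulmxA => <-.
have -> : es *m c *m b *m u *m b' *m e = es *m c *m (b *m u *m b' *m e).
  by rewrite !mulmxA.
have -> : es *m b *m u *m b' *m c *m e = es *m (b *m u *m b') *m c *m e.
  by rewrite !mulmxA.
rewrite ubE mulmxDr esA add0r mulmxDl Ae add0r -(mulmxA es B).
by rewrite (poly_in_commute pc Bt) !mulmxA.
Qed.

Lemma square_scalar :
  (forall x, poly_in t_h x ->
     es *m b *m (x *m one_h) = es *m b' *m (x *m one_h) *m (b *m b)) ->
  exists r s, r * s = 1 /\ b *m b = r%:M.
Proof.
move=> bH; have pb := commute_poly_in bt.
have pbeta := poly_in_mul pb pb.
have lb : es *m b = es *m b' *m (b *m b).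
  by rewrite -mulmxA (mulmxA b') b'b mul1mx.
rewrite lb in bH.
(* With l = e^* b' and v = b e one has l v = 1, so e^* b^2 is a multiple of e^*. *)
have := commutation_spreads pbeta bH (b *m e).
have -> : es *m b' *m (b *m e) = 1%:M by rewrite mulmxA -(mulmxA es) b'b mulmx1 es_e.
rewrite mul1mx -lb [X in _ = X *m _]mx11_scalar mul_scalar_mx.
set r := fun_of_matrix _ 0 0 => es_beta.
have betaE : b *m b = r%:M.
  apply: commute_form_inj; [exact: poly_in_commutes|by rewrite scalar_mxC|].
  by rewrite mul_mx_scalar.
(* The inverse of r comes from 1 = e^* e = e^* b^2 b'^2 e = r (e^* b'^2 e). *)
exists r, ((es *m (b' *m b') *m e) 0 0); split=> //.
have := congr1 (fun m : 'M[R]_1 => m 0 0) es_e.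
rewrite [RHS]mxE eqxx mulr1n => <-.
have -> : es *m e = r *: (es *m (b' *m b') *m e).
  rewrite -[es in LHS]mulmx1 -bb' -[b in LHS]mulmx1 -bb' -!mulmxA (mulmxA b b) betaE.
  by rewrite mul_scalar_mx -!scalemxAr.
by rewrite [RHS]mxE.
Qed.

End Conjugation.

End StableMatrix.

(** * Matrices x + y eps over the dual numbers *)

Section DualMatrices.
Variable R : comPzRingType.

Lemma dual_inf_sum (I : finType) (F : I -> dual R) :
  dual_inf (\sum_i F i) = \sum_i dual_inf (F i).
Proof. by apply: (big_morph (@dual_inf R)). Qed.

Definition dual_mx (m n : nat) (x y : 'M[R]_(m, n)) : 'M[dual R]_(m, n) :=
  \matrix_(i, j) Dual (x i j) (y i j).

Lemma dual_mxE (m n : nat) (x : 'M[dual R]_(m, n)) :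
  x = dual_mx (map_mx (@dual_std R) x) (map_mx (@dual_inf R) x).
Proof. by apply/matrixP=> i j; rewrite !mxE; case: (x i j). Qed.

Lemma std_dual_mx (m n : nat) (x y : 'M[R]_(m, n)) :
  map_mx (@dual_std R) (dual_mx x y) = x.
Proof. by apply/matrixP=> i j; rewrite !mxE. Qed.

Lemma inf_dual_mx (m n : nat) (x y : 'M[R]_(m, n)) :
  map_mx (@dual_inf R) (dual_mx x y) = y.
Proof. by apply/matrixP=> i j; rewrite !mxE. Qed.

Lemma dual_mx_inj (m n : nat) (x y z w : 'M[R]_(m, n)) :
  dual_mx x y = dual_mx z w -> x = z /\ y = w.
Proof.
move=> E; split; first by rewrite -(std_dual_mx x y) E std_dual_mx.
by rewrite -(inf_dual_mx x y) E inf_dual_mx.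
Qed.

Lemma dual_mxM (m n p : nat) (x y : 'M[R]_(m, n)) (z w : 'M[R]_(n, p)) :
  dual_mx x y *m dual_mx z w = dual_mx (x *m z) (x *m w + y *m z).
Proof.
rewrite [LHS]dual_mxE map_mxM !std_dual_mx; congr dual_mx.
apply/matrixP=> i j; rewrite !mxE dual_inf_sum -big_split.
by apply: eq_bigr => k _; rewrite !mxE.
Qed.

Lemma const_dual_mx (m n : nat) (x : 'M[R]_(m, n)) :
  map_mx (@dual_const R) x = dual_mx x 0.
Proof. by apply/matrixP=> i j; rewrite !mxE. Qed.

Lemma dual_mx1 (n : nat) : 1%:M = dual_mx 1%:M 0 :> 'M_n.
Proof. by rewrite -const_dual_mx map_mx1. Qed.

Lemma dual_mx_in_G (n : nat) (g k : 'M[R]_n) : in_G (dual_mx g k) <-> in_G g.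
Proof.
split=> [[g' []]|[g' [gg' g'g]]].
  rewrite (dual_mxE g') !dual_mxM !dual_mx1 => /dual_mx_inj[gg' _] /dual_mx_inj[g'g _].
  by exists (map_mx (@dual_std R) g').
(* (g + eps k)^-1 = g^-1 - eps g^-1 k g^-1. *)
exists (dual_mx g' (- (g' *m k *m g'))); rewrite !dual_mxM !dual_mx1 gg' g'g.
rewrite mulmxN mulNmx !mulmxA gg' mul1mx addNr.
by rewrite -(mulmxA _ g') g'g mulmx1 subrr.
Qed.

Variables (n : nat) (e : 'cV[int]_n) (es : 'rV[int]_n).

Lemma dual_base_vec : base_vec e (dual R) = dual_mx (base_vec e R) 0.
Proof. by rewrite -const_dual_mx; apply/matrixP=> i j; rewrite !mxE rmorph_int. Qed.

Lemma dual_base_form : base_form es (dual R) = dual_mx (base_form es R) 0.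
Proof. by rewrite -const_dual_mx; apply/matrixP=> i j; rewrite !mxE rmorph_int. Qed.

Lemma dual_mx_in_H (h k : 'M[R]_n) :
  in_H e es (dual_mx h k) <->
  [/\ in_H e es h, k *m base_vec e R = 0 & base_form es R *m k = 0].
Proof.
rewrite /in_H dual_base_vec dual_base_form !dual_mxM !(mulmx0, mul0mx, add0r, addr0).
split=> [[/dual_mx_in_G hG /dual_mx_inj[he ke] /dual_mx_inj[eh ek]]|].
  by [].
by case=> -[hG -> ->] -> ->; split=> //; apply/dual_mx_in_G.
Qed.

Lemma dual_mx_commute (t x y : 'M[R]_n) :
  dual_mx x y *m map_mx (@dual_const R) t = map_mx (@dual_const R) t *m dual_mx x y <->
  x *m t = t *m x /\ y *m t = t *m y.
Proof.
rewrite const_dual_mx !dual_mxM !(mulmx0, mul0mx, add0r, addr0).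
by split=> [/dual_mx_inj//|[-> ->]].
Qed.

End DualMatrices.

(** * Uniqueness of the factorization and tangent vectors at y *)

Section TangentialPoints.
Variables (n : nat) (e : 'cV[int]_n) (es : 'rV[int]_n).
Hypothesis hes : es *m e = 1%:M.
Variables (R : comPzRingType) (tau : 'M[R]_n).
Hypothesis htau : stable e es tau.

Local Notation E := (base_vec e R).
Local Notation ES := (base_form es R).
Local Notation one_H := (one_H e es R).
Local Notation tau_H := (restr_H e es tau).

Lemma base_formM : ES *m E = 1%:M.
Proof. by rewrite -map_mxM hes map_mx1. Qed.

Lemma stable_vec (v : 'cV[R]_n) : exists2 x, poly_in tau x & v = x *m E.
Proof. by have [x /poly_in_alg_gen px ->] := htau.1 v; exists x. Qed.

Lemma stable_form (l : 'rV[R]_n) : exists2 x, poly_in tau x & l = ES *m x.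
Proof. by have [x /poly_in_alg_gen px ->] := htau.2 l; exists x. Qed.

Lemma in_GcentE g : in_Gcent (@idfun R) tau g <-> in_G g /\ g *m tau = tau *m g.
Proof. by rewrite /in_Gcent map_mx_id. Qed.

Lemma in_HcentE s g : in_Hcent e es (@idfun R) s g <-> in_H e es g /\ g *m s = s *m g.
Proof. by rewrite /in_Hcent map_mx_id. Qed.

(** h2^-1 h = b2 b^-1 fixes e and commutes with tau, hence is 1. *)
Lemma decomp_unique (h b h2 b2 : 'M[R]_n) :
  in_H e es h -> in_Gcent (@idfun R) tau b ->
  in_H e es h2 -> in_Gcent (@idfun R) tau b2 ->
  h *m b = h2 *m b2 -> h = h2 /\ b = b2.
Proof.
case=> _ hE _ /in_GcentE[[b' [bb' b'b]] bt].
case=> -[h2' [hh' h'h]] hE2 _ /in_GcentE[_ bt2] eq_hb.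
have hE' : h2' *m E = E by rewrite -[in LHS]hE2 mulmxA h'h mul1mx.
have g1 : h2' *m h = b2 *m b'.
  by rewrite -[LHS]mulmx1 -bb' mulmxA -(mulmxA _ h) eq_hb mulmxA h'h mul1mx.
have gt : b2 *m b' *m tau = tau *m (b2 *m b').
  by rewrite -mulmxA (inverse_commute bb' b'b bt) mulmxA bt2 !mulmxA.
have b21 : b2 *m b' = 1%:M.
  apply: (commute_inj stable_vec gt); first by rewrite mulmx1 mul1mx.
  by rewrite -g1 -mulmxA hE hE' mul1mx.
split; first by rewrite -[LHS]mul1mx -hh' -mulmxA g1 b21 mulmx1.
by rewrite -[RHS]mulmx1 -b'b mulmxA b21 mul1mx.
Qed.

Variables (a y h b : 'M[R]_n).
Hypothesis hy : in_Hcent e es (@idfun R) tau_H y.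
Hypotheses (hh : in_H e es h) (hb : in_Gcent (@idfun R) tau b).
Hypothesis ay : a *m y = h *m b.

Lemma tangential_of_square : in_Z (b *m b) -> tangential e es tau a y.
Proof.
case=> r [s [rs b2]] y'; rewrite (dual_mxE y') std_dual_mx.
set y1 := map_mx (@dual_inf R) y'; move=> hy' yE; rewrite yE in hy' *; split=> //.
case: hy' => /dual_mx_in_H[[[yi [yyi yiy]] yE' Ey] y1E Ey1] /dual_mx_commute[ys y1s].
case/in_GcentE: hb => -[b' [bb' b'b]] bt; case: hh => hG hE Eh.
have [x px y1x] : exists2 x, poly_in tau_H x & yi *m y1 = x *m one_H.
  apply: (centralizer_h base_formM stable_vec erefl erefl).
  - by rewrite -mulmxA y1E mulmx0.
  - by rewrite mulmxA -[ES in LHS]Ey -(mulmxA ES) yyi mulmx1.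
  - by rewrite -mulmxA y1s (mulmxA yi tau_H) (inverse_commute yyi yiy ys) mulmxA.
have uu := adjoint_poly_h base_formM stable_vec erefl erefl px.
have [A [B [uE AE EA Bt]]] := conj_decomp stable_vec bt b'b rs b2 uu.
(* These are h(1 + eps A) and (1 + eps B)b. *)
exists (dual_mx h (h *m A)), (dual_mx b (B *m b)); split.
- by apply/dual_mx_in_H; rewrite -mulmxA AE mulmx0 mulmxA Eh EA.
- split; first by apply/dual_mx_in_G; exists b'.
  by apply/dual_mx_commute; rewrite -mulmxA bt !mulmxA Bt.
- rewrite const_dual_mx !dual_mxM mul0mx addr0 ay; congr dual_mx.
  rewrite -[y1]mul1mx -yyi -(mulmxA y) y1x (mulmxA a) ay.
  rewrite -(mulmxA h A) -mulmxDr -mulmxDl addrC -uE -(mulmxA _ b') b'b mulmx1.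
  by rewrite -[LHS]mulmxA.
Qed.

Lemma square_of_tangential : tangential e es tau a y -> in_Z (b *m b).
Proof.
move=> tan; case/in_HcentE: hy => -[[y' [yy' y'y]] yE Ey] ys.
case/in_GcentE: hb => -[b' [bb' b'b]] bt.
apply: (square_scalar base_formM stable_vec stable_form erefl erefl bt bb' b'b) => x px.
have xC : one_H *m x = x *m one_H.
  exact: poly_in_commute px (one_h_commute base_formM erefl erefl).
have uE : x *m one_H *m E = 0 by rewrite -mulmxA (one_h_e base_formM) ?mulmx0.
have Eu : ES *m (x *m one_H) = 0.
  by rewrite -xC mulmxA (es_one_h base_formM) ?mul0mx.
have us : x *m one_H *m tau_H = tau_H *m (x *m one_H).
  rewrite -(mulmxA x) (one_h_commute base_formM erefl erefl) (mulmxA x tau_H).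
  by rewrite (poly_in_commutes px) mulmxA.
(* Test tangentiality on y(1 + eps u) with u = x 1_H. *)
have [||_ [h' [b0']]] := tan (dual_mx y (y *m (x *m one_H))).
- split; last first.
    apply/dual_mx_commute; split=> //.
    by rewrite -(mulmxA y) us (mulmxA y tau_H) ys -[LHS]mulmxA.
  apply/dual_mx_in_H; split; first by split=> //; exists y'.
    by rewrite -mulmxA uE mulmx0.
  by rewrite mulmxA Ey Eu.
- exact: std_dual_mx.
rewrite (dual_mxE h') (dual_mxE b0').
move: (map_mx _ h') (map_mx _ b0') (map_mx _ h') (map_mx _ b0') => h1 b1 h0 b0.
case=> /dual_mx_in_H[hH0 h1E Eh1] [/dual_mx_in_G bG0 /dual_mx_commute[bt0 bt1]].
rewrite const_dual_mx !dual_mxM mul0mx addr0 => /dual_mx_inj[ayE].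
rewrite mulmxA ay in ayE *.
have [] := decomp_unique hh hb hH0 _ ayE; first by apply/in_GcentE.
move=> <- <- ubE; case: hh => -[hi [hhi hih]] hE Eh.
have Ehi : ES *m hi = ES by rewrite -[in LHS]Eh -mulmxA hhi mulmx1.
(* The eps-part b u = h^-1 (h b1 + h1 b), multiplied by b^-1 on the right, gives B = b1 b^-1 and A =
   h^-1 h1. *)
apply: (conj_decomp_adjoint (A := hi *m h1) (B := b1 *m b') stable_vec bt bb' b'b).
- exact: (adjoint_poly_h base_formM stable_vec erefl erefl px).
- have -> : b *m (x *m one_H) = hi *m (h *m b1 + h1 *m b).
    by rewrite -ubE -(mulmxA h) (mulmxA hi) hih mul1mx.
  rewrite mulmxDr mulmxDl addrC !mulmxA hih mul1mx.
  by rewrite -(mulmxA _ b b') bb' mulmx1.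
- by rewrite -mulmxA h1E mulmx0.
- by rewrite mulmxA Ehi Eh1.
- by rewrite -mulmxA (inverse_commute bb' b'b bt) mulmxA bt1 mulmxA.
Qed.

End TangentialPoints.

Theorem theorem5p5 (n : nat) (e : 'cV[int]_n) (es : 'rV[int]_n)
    (hes : es *m e = 1%:M)
    (R : comPzRingType) (tau a y : 'M[R]_n)
    (htau : stable e es tau) (ha : in_G a)
    (hy : in_X e es tau a (@idfun R) y) :
  (exists! hb : 'M[R]_n * 'M[R]_n,
     [/\ in_H e es hb.1, in_Gcent (@idfun R) tau hb.2
       & a *m y = hb.1 *m hb.2]) /\
  (forall h b : 'M[R]_n,
     in_H e es h -> in_Gcent (@idfun R) tau b -> a *m y = h *m b ->
     (tangential e es tau a y <-> in_Z (b *m b))).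
Proof.
case: hy => hyH [h [b [hh hb]]]; rewrite map_mx_id // => ay; split.
  exists (h, b); split=> // -[h2 b2] [/= hh2 hb2 ay2].
  by have [-> ->] := decomp_unique htau hh hb hh2 hb2 (etrans (esym ay) ay2).
move=> {hh hb ay} {}h {}b hh hb ay; split.
  exact (square_of_tangential hes htau hyH hh hb ay).
exact (tangential_of_square hes htau hh hb ay).
Qed.
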